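(* For every integer $m\geq 2$, $S(m)+S(m^2)=\left[0,\frac{m+1}{m^2}\right]$.
   Context: For $x\in[0,1]$, $a_n(x)$ is the $n$-th partial quotient of its regular continued fraction $x=[a_1,a_2,\ldots]=1/(a_1+1/(a_2+\cdots))$; rationals are written with last partial quotient at least $2$ (and $1=[1]$). For an integer $k\geq1$, $S(k)=\{x\in[0,1]: a_n(x)\geq k \text{ for all } n\}$, where a rational belongs to $S(k)$ if all its defined partial quotients are $\geq k$, and $0\in S(k)$. $S(m)+S(m^2)=\{c+b: c\in S(m), b\in S(m^2)\}$. *)

(* Defs.v *)
From mathcomp Require Import all_boot all_order all_algebra.
From mathcomp Require Import all_classical all_reals.

Set Implicit Arguments.
Unset Strict Implicit.
Unset Printing Implicit Defensive.

Import Order.TTheory GRing.Theory Num.Theory.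
Local Open Scope classical_set_scope.
Local Open Scope ring_scope.

(* The Gauss map x |-> 1/x - floor(1/x); since 0^-1 = 0, it sends 0 to 0. *)
Definition gauss_map (R : realType) (x : R) : R :=
  x^-1 - (Num.floor x^-1)%:~R.

(* For x in [0, 1] and n >= 1, the n-th partial quotient a_n(x), or None when
   the expansion has fewer than n terms.  For y != 0 in [0, 1] one has
   y = 1 / (truncn (1 / y) + gauss_map y), and the expansion stops once an
   iterate vanishes; 0 has no partial quotient.  All iterates after x itself
   lie in [0, 1[, so the last partial quotient of a rational in ]0, 1[ is at
   least 2, whereas 1 = [1].  The index n starts at 1; n = 0 is irrelevant. *)
Definition partial_quotient (R : realType) (x : R) (n : nat) : option nat :=
  let y := iter n.-1 (@gauss_map R) x in
  if y == 0 then None else Some (Num.truncn y^-1).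

Definition cfS (R : realType) (k : nat) : set R :=
  [set x : R | 0 <= x <= 1 /\
     forall n a : nat, (1 <= n)%N -> partial_quotient x n = Some a ->
       (k <= a)%N].

Arguments cfS : clear implicits.

(* Main.v *)
Require Import Defs.
From mathcomp Require Import all_boot all_order all_algebra.
From mathcomp Require Import all_classical all_reals.
From mathcomp Require Import ring lra.

(* Remove from [0, 1/k] the gaps between successive cylinders a_1 = a, a_1 = a + 1,
   ..., and so on recursively.  The closed intervals that remain at some stage
   (bridges) have end points p/q and P/Q with |P q - p Q| = 1, so they have length
   1/(q Q); deleting a gap of length (k - 1)/((Q + q)(k Q + q)) leaves a large piece
   with denominators (q, Q + q), which keeps the end p/q, and a small one with
   denominators (Q, k Q + q), which keeps the end P/Q and is oppositely oriented.

   Let A, with denominators (q, Q), be a bridge for k = m and B, with denominators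
   (s, S), one for k = m^2.  The product of the thicknesses is below 1, so the usual
   gap argument fails, and the relative orientation of A and B has to be used.  Call
   (A, B) linked if the gap of A is at most as long as B and moreover
   - A and B have the same orientation and m Q <= S, or
   - they have opposite orientations, m Q <= m^2 S + s, m q <= S and
     (m^2 - m + 1) s <= Q + q.
   For a linked pair, A + B is covered by two smaller linked sums.  Iterating, every
   point of [0, 1/m] + [0, 1/m^2] is a limit of sums of linked bridges whose
   denominators tend to infinity. *)

Set Implicit Arguments.
Unset Strict Implicit.
Unset Printing Implicit Defensive.

Import Order.TTheory GRing.Theory Num.Theory.
Local Open Scope classical_set_scope.
Local Open Scope ring_scope.

(** * Inequalities between denominators *)

Section Ineq.
Variable F : realFieldType.
Implicit Types M q Q s S Y : F.

(** Gaps shrink as denominators grow: the gap of a piece of A is at most the gap of A, hence still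
    at most as long as an interval that bounded the latter. *)
Lemma gap_den_mono M q Q q' Q' : 0 <= M -> 0 <= q <= q' -> 0 <= Q <= Q' ->
  (Q + q) * (M * Q + q) <= (Q' + q') * (M * Q' + q').
Proof.
move=> M0 /andP[q0 qq'] /andP[Q0 QQ'].
by rewrite ler_pM ?addr_ge0 ?lerD ?mulr_ge0 ?ler_wpM2l.
Qed.

(** Aligned case: if B is shortened towards its end of denominator s, with the other denominator Y
    at most s above M (Q + q), the gap of A is still no longer than B. *)
Lemma same_left_ineq M q Q s S Y : 2 <= M -> 0 < q -> M * q <= Q -> 0 < s ->
  M ^+ 2 * s <= S -> S < M * (Q + q) -> Y <= M * (Q + q) + s ->
  (M - 1) * (s * Y) <= (Q + q) * (M * Q + q).
Proof.
move=> M2 q0 qQ s0 sS Sw Yw.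
have Msw : M * s <= Q + q.
  by rewrite -(ler_pM2l (_ : 0 < M)) //; [nra | lra].
have zw : (M ^+ 2 + 1) * (Q + q) <= (M + 1) * (M * Q + q) by nra.
have w0 : 0 < Q + q by nra.
have sY : M * (s * Y) <= (M ^+ 2 + 1) * (s * (Q + q)).
  have : M * s * Y <= M * s * (M * (Q + q) + s) by rewrite ler_wpM2l //; nra.
  have : s * (M * s) <= s * (Q + q) by rewrite ler_wpM2l //; lra.
  nra.
have wz : (M ^+ 2 + 1) * (M * (s * (Q + q))) <= (M + 1) * ((Q + q) * (M * Q + q)).
  have : (M ^+ 2 + 1) * (Q + q) * (M * s) <= (M ^+ 2 + 1) * (Q + q) * (Q + q).
    by rewrite ler_wpM2l //; nra.
  have : (Q + q) * ((M ^+ 2 + 1) * (Q + q)) <= (Q + q) * ((M + 1) * (M * Q + q)).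
    by rewrite ler_wpM2l //; lra.
  nra.
rewrite -(ler_pM2l (_ : 0 < M * (M + 1))); last by nra.
have h1 : (M ^+ 2 - 1) * (M * (s * Y)) <= (M ^+ 2 - 1) * ((M ^+ 2 + 1) * (s * (Q + q))).
  by rewrite ler_wpM2l //; nra.
have h2 : M * ((M ^+ 2 + 1) * (M * (s * (Q + q)))) <= M * ((M + 1) * ((Q + q) * (M * Q + q))).
  by rewrite ler_wpM2l //; lra.
have h3 : 0 <= (M ^+ 2 + 1) * (s * (Q + q)).
  by rewrite mulr_ge0 ?mulr_ge0 //; nra.
nra.
Qed.

(** An aligned pair becomes opposed when A is replaced by its tip; this is the bound on s then
    required. Relative to u = M Q + q + Q, both Q + q and M Q + q are largest at Q = M q, so too
    large an s violates the gap bound by a polynomial inequality in M. *)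
Lemma same_tip_ineq M q Q s S : 2 <= M -> 0 < q -> M * q <= Q -> 0 < s ->
  M ^+ 2 * s <= S -> (M - 1) * (s * S) <= (Q + q) * (M * Q + q) ->
  (M ^+ 2 - M + 1) * s <= M * Q + q + Q.
Proof.
move=> M2 q0 qQ s0 sS H; rewrite leNgt; apply/negP.
set u := M * Q + q + Q; set D := M ^+ 2 - M + 1 => uD.
have K0 : 0 < M ^+ 2 + M + 1 by nra.
have Q0 : 0 < Q by nra.
have wu : (M ^+ 2 + M + 1) * (Q + q) <= (M + 1) * u by rewrite /u; nra.
have zu : (M ^+ 2 + M + 1) * (M * Q + q) <= (M ^+ 2 + 1) * u by rewrite /u; nra.
have u0 : 0 < u by rewrite /u; nra.
have wz : (M ^+ 2 + M + 1) * (Q + q) * ((M ^+ 2 + M + 1) * (M * Q + q)) <=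
   (M + 1) * u * ((M ^+ 2 + 1) * u) by rewrite ler_pM // mulr_ge0 ?(ltW K0) //; nra.
have uu : u * u <= D * s * (D * s) by rewrite ler_pM //; lra.
have low : (M - 1) * (M ^+ 2 * s * s) <= (Q + q) * (M * Q + q).
  have : s * (M ^+ 2 * s) <= s * S by rewrite ler_wpM2l //; lra.
  nra.
have ss0 : 0 < s * s by rewrite mulr_gt0.
have : (M ^+ 2 + M + 1) ^+ 2 * ((M - 1) * (M ^+ 2 * (s * s))) <=
    (M + 1) * (M ^+ 2 + 1) * (D * D * (s * s)).
  have h1 : (M ^+ 2 + M + 1) ^+ 2 * ((M - 1) * (M ^+ 2 * s * s)) <=
     (M ^+ 2 + M + 1) ^+ 2 * ((Q + q) * (M * Q + q)).
    by rewrite ler_wpM2l // sqr_ge0.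
  have h2 : (M + 1) * (M ^+ 2 + 1) * (u * u) <= (M + 1) * (M ^+ 2 + 1) * (D * s * (D * s)).
    by rewrite ler_wpM2l // mulr_ge0 //; nra.
  lra.
(* Once expanded, the leading term 2 M^6 dominates, as each power of M is at least twice the
   preceding one. *)
have poly : 0 < (M ^+ 2 + M + 1) ^+ 2 * ((M - 1) * M ^+ 2) - (M + 1) * (M ^+ 2 + 1) * (D * D).
  have -> : (M ^+ 2 + M + 1) ^+ 2 * ((M - 1) * M ^+ 2) - (M + 1) * (M ^+ 2 + 1) * (D * D) =
    2 * M ^+ 6 - M ^+ 5 - M ^+ 4 - M ^+ 3 - 3 * M ^+ 2 + M - 1 by rewrite /D; ring.
  have M1 : 2 * M <= M ^+ 2 by nra.
  have M3 : 2 * M ^+ 2 <= M ^+ 3 by rewrite [leRHS]exprS ler_wpM2r // sqr_ge0.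
  have M4 : 2 * M ^+ 3 <= M ^+ 4 by rewrite [leRHS]exprS ler_wpM2r // exprn_ge0; lra.
  have M5 : 2 * M ^+ 4 <= M ^+ 5 by rewrite [leRHS]exprS ler_wpM2r // exprn_ge0; lra.
  have M6 : 2 * M ^+ 5 <= M ^+ 6 by rewrite [leRHS]exprS ler_wpM2r // exprn_ge0; lra.
  lra.
have := mulr_gt0 poly ss0; lra.
Qed.

(** Opposed case, before passing to the tip of A: B may be shortened until Y is about M (M Q + q),
    and the gap of A still fits. *)
Lemma opp_tip_ineq M q Q s Y : 2 <= M -> 0 < q -> M * q <= Q -> 0 < s ->
  (M ^+ 2 - M + 1) * s <= Q + q -> Y <= M * (M * Q + q) + s ->
  (M - 1) * (s * Y) <= (Q + q) * (M * Q + q).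
Proof.
move=> M2 q0 qQ s0 D Yz.
have Q0 : 0 < Q by nra.
have z0 : 0 < M * Q + q by nra.
have MQ : 0 <= (M - 1) * Q by rewrite mulr_ge0 //; lra.
have M1s : 0 <= (M - 1) ^+ 2 * s by rewrite mulr_ge0 ?sqr_ge0 // ltW.
have sz : (M - 1) * s <= M * Q + q by lra.
have h1 : (M ^+ 2 - M + 1) * s * (M * Q + q) <= (Q + q) * (M * Q + q).
  by rewrite ler_wpM2r //; lra.
have h2 : (M - 1) * s * Y <= (M - 1) * s * (M * (M * Q + q) + s).
  by rewrite ler_wpM2l //; nra.
have h3 : (M - 1) * s * s <= (M * Q + q) * s by rewrite ler_wpM2r //; lra.
lra.
Qed.

(** Opposed case with A kept and B cut to its trunk, of denominators (s, S + s). *)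
Lemma opp_left_ineq M q Q s S : 2 <= M -> 0 < q -> M * q <= Q -> 0 < s ->
  (M ^+ 2 - M + 1) * s <= Q + q -> M ^+ 2 * S + s < M * (Q + q) ->
  (M - 1) * (s * (S + s)) <= (Q + q) * (M * Q + q).
Proof.
move=> M2 q0 qQ s0 D Sw.
have Q0 : 0 < Q by nra.
have w0 : 0 < Q + q by lra.
have MQ : 0 <= (M - 1) * Q by rewrite mulr_ge0 //; lra.
have M1s : 0 <= (M - 1) ^+ 2 * s by rewrite mulr_ge0 ?sqr_ge0 // ltW.
have M2s : 0 <= (M - 2) * (M + 1) * s by rewrite !mulr_ge0 //; lra.
have MS : M * S <= Q + q.
  by rewrite -(ler_pM2l (_ : 0 < M)); nra.
have h1 : (M - 1) * s * (M * S) <= (M - 1) * s * (Q + q) by rewrite ler_wpM2l //; nra.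
have h3 : (M - 1) * (s * S) <= s * (Q + q).
  rewrite -(ler_pM2l (_ : 0 < M)); last by lra.
  by have := mulr_gt0 s0 w0; nra.
have h4 : (M - 1) * s <= Q + q by lra.
have h5 : s * ((M - 1) * s) <= s * (Q + q) by rewrite ler_wpM2l //; lra.
have h6 : 2 * s <= M * Q + q by lra.
have : (Q + q) * (2 * s) <= (Q + q) * (M * Q + q) by rewrite ler_wpM2l //; lra.
lra.
Qed.

(** Opposed case with A kept and B cut to its tip, of denominators (S, M^2 S + s). *)
Lemma opp_switch_ineq M q Q s S : 2 <= M -> 0 < q -> 0 < s -> 0 < S -> M * q <= S ->
  M ^+ 2 * S + s < M * (Q + q) ->
  (M - 1) * (S * (M ^+ 2 * S + s)) <= (Q + q) * (M * Q + q).
Proof.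
move=> M2 q0 s0 S0 qS Pw.
have P0 : 0 < M ^+ 2 * S + s by nra.
have h : M * ((M - 1) * S) <= M * Q + q by nra.
rewrite -(ler_pM2l (_ : 0 < M)); last by lra.
have := ler_pM (ltW P0) _ (ltW Pw) h.
have -> : 0 <= M * ((M - 1) * S) by rewrite !mulr_ge0 //; lra.
move=> /(_ isT); lra.
Qed.

(** When B is cut instead of A, the gap of B has to be at most the length 1/(q Q) of A. *)
Lemma opp_gap_ineq M q Q s S : 2 <= M -> 0 < q -> 0 < Q -> 0 < s -> 0 < S -> M * q <= S ->
  M * Q <= M ^+ 2 * S + s ->
  (M ^+ 2 - 1) * (q * Q) <= (S + s) * (M ^+ 2 * S + s).
Proof.
move=> M2 q0 Q0 s0 S0 qS QP.
have := ler_pM _ _ qS QP.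
have -> : 0 <= M * q by rewrite mulr_ge0 //; lra.
have -> : 0 <= M * Q by rewrite mulr_ge0 //; lra.
move=> /(_ isT isT).
have := mulr_gt0 q0 Q0.
have : 0 < s * (M ^+ 2 * S + s) by rewrite mulr_gt0 //; nra.
lra.
Qed.
End Ineq.

(** * Bridges *)

(* [lden] <= [fden]: the end [lnum / lden] belongs to the large piece and is the
   limit of the pieces [iter j trunk A]; [sgn] is 1 when it is the left end, and
   -1 otherwise. *)
Record bridge (R : Type) :=
  Bridge { sgn : R; lnum : R; lden : R; fnum : R; fden : R }.

Section Bridges.
Variable R : realType.
Implicit Types (A B : bridge R) (k : nat) (x : R).

Definition root_bridge k : bridge R := Bridge 1 0 1 1 k%:R.

(** A bridge prescribes some first quotients and a lower bound for the next one. [trunk] raises this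
    bound by 1; [tip] fixes the quotient at the bound and asks the following one to be at least
    k. *)
Definition trunk A : bridge R :=
  Bridge (sgn A) (lnum A) (lden A) (fnum A + lnum A) (fden A + lden A).

Definition tip k A : bridge R :=
  Bridge (- sgn A) (fnum A) (fden A)
    (k%:R * fnum A + lnum A) (k%:R * fden A + lden A).

Inductive is_bridge k : bridge R -> Prop :=
| is_bridge_root : is_bridge k (root_bridge k)
| is_bridge_trunk A : is_bridge k A -> is_bridge k (trunk A)
| is_bridge_tip A : is_bridge k A -> is_bridge k (tip k A).

Definition in_bridge A x :=
  0 <= sgn A * (x * lden A - lnum A) /\ 0 <= sgn A * (fnum A - x * fden A).

Definition lend A := lnum A / lden A.
Definition fend A := fnum A / fden A.

Lemma is_bridgeP k A : (1 <= k)%N -> is_bridge k A ->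
  [/\ sgn A = 1 \/ sgn A = -1, sgn A * (fnum A * lden A - lnum A * fden A) = 1,
    1 <= lden A & k%:R * lden A <= fden A].
Proof.
move=> k1; have {k1}k1 : 1 <= k%:R :> R by rewrite ler1n.
elim=> /= [|{}A _ [s d q Q]|{}A _ [s d q Q]].
- by split; [left| ring | |rewrite mulr1].
- split => //; [by rewrite -d; ring | lra].
- split; [by case: s => ->; rewrite ?opprK; [right | left] | by rewrite -d; ring | | lra].
  by apply: le_trans Q; rewrite -[leLHS]mulr1 ler_pM.
Qed.

Lemma lden_le_fden k A : (1 <= k)%N -> is_bridge k A -> lden A <= fden A.
Proof.
move=> k1 kA; have [_ _ q Q] := is_bridgeP k1 kA.
by apply: le_trans Q; rewrite ler_peMl ?ler1n //; lra.
Qed.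

Lemma fden_gt0 k A : (1 <= k)%N -> is_bridge k A -> 0 < fden A.
Proof.
move=> k1 kA; have [_ _ q _] := is_bridgeP k1 kA.
by have := lden_le_fden k1 kA; lra.
Qed.

Lemma trunk_sub k A x : (1 <= k)%N -> is_bridge k A ->
  in_bridge (trunk A) x -> in_bridge A x.
Proof. by move=> k1 kA [/= u v]; split=> //=; lra. Qed.

Lemma tip_sub k A x : (1 <= k)%N -> is_bridge k A ->
  in_bridge (tip k A) x -> in_bridge A x.
Proof.
move=> k1 kA [/= u v]; split=> /=; last by lra.
have : 0 <= k%:R * (- sgn A * (x * fden A - fnum A)) by rewrite mulr_ge0.
lra.
Qed.

Lemma bridge_length k A : (1 <= k)%N -> is_bridge k A ->
  sgn A * (fend A - lend A) = (lden A * fden A)^-1.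
Proof.
move=> k1 kA; have [_ d q _] := is_bridgeP k1 kA; have Q := fden_gt0 k1 kA.
rewrite -[RHS]mul1r -d /fend /lend; field.
by rewrite !gt_eqF //; lra.
Qed.

Lemma gap_length k A : (1 <= k)%N -> is_bridge k A ->
  sgn A * (fend (tip k A) - fend (trunk A)) =
  (k%:R - 1) / ((fden A + lden A) * (k%:R * fden A + lden A)).
Proof.
move=> k1 kA; have [_ d q _] := is_bridgeP k1 kA; have Q := fden_gt0 k1 kA.
have k1R : 1 <= k%:R :> R by rewrite ler1n.
rewrite -[k%:R - 1]mulr1 -[X in _ * X / _]d /fend /=; field.
by rewrite !gt_eqF //; nra.
Qed.

Lemma iter_trunk k A j : is_bridge k A ->
  [/\ is_bridge k (iter j trunk A), sgn (iter j trunk A) = sgn A,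
      lnum (iter j trunk A) = lnum A, lden (iter j trunk A) = lden A &
      fden (iter j trunk A) = fden A + j%:R * lden A].
Proof.
move=> kA; elim: j => [|j [kj s p q Q]] /=; first by rewrite mul0r addr0.
split=> //; first exact: is_bridge_trunk.
by rewrite Q q -natr1; ring.
Qed.

Lemma iter_trunk_sub k A j x : (1 <= k)%N -> is_bridge k A ->
  in_bridge (iter j trunk A) x -> in_bridge A x.
Proof.
move=> k1 kA; elim: j => //= j IH /(trunk_sub k1) H; apply/IH/H.
by case: (iter_trunk j kA).
Qed.

(** Each trunk step adds [lden A] to the outer denominator, so stopping as soon as y is passed
    overshoots by at most [lden A]. *)
Lemma iter_trunk_ge k A (y : R) : (1 <= k)%N -> is_bridge k A ->
  exists j, y <= fden (iter j trunk A) /\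
   (iter j trunk A = A \/ fden A < y /\ fden (iter j trunk A) <= y + lden A).
Proof.
move=> k1 kA; have [_ _ q _] := is_bridgeP k1 kA.
have [yA|Ay] := leP y (fden A); first by exists 0; split => //; left.
have q0 : 0 < lden A by lra.
have r0 : 0 <= (y - fden A) / lden A by rewrite divr_ge0 //; lra.
exists (Num.truncn ((y - fden A) / lden A)).+1.
have [_ _ _ _ ->] := iter_trunk (Num.truncn ((y - fden A) / lden A)).+1 kA.
have /andP[] := truncn_itv r0.
rewrite ler_pdivlMr // ltr_pdivrMr // -natr1 => h1 h2.
by split; [lra | right; split => //; lra].
Qed.

Lemma in_bridgeE k A x : (1 <= k)%N -> is_bridge k A ->
  in_bridge A x <-> 0 <= sgn A * (x - lend A) /\ 0 <= sgn A * (fend A - x).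
Proof.
move=> k1 kA; have [_ _ q _] := is_bridgeP k1 kA; have Q := fden_gt0 k1 kA.
have q0 : 0 < lden A by lra.
have -> : sgn A * (x - lend A) = sgn A * (x * lden A - lnum A) / lden A.
  by rewrite /lend; field; rewrite gt_eqF.
have -> : sgn A * (fend A - x) = sgn A * (fnum A - x * fden A) / fden A.
  by rewrite /fend; field; rewrite gt_eqF.
by rewrite !ler_pdivlMr // !mul0r.
Qed.

Lemma in_bridge_itv k A x : (1 <= k)%N -> is_bridge k A ->
  in_bridge A x <-> Num.min (lend A) (fend A) <= x <= Num.max (lend A) (fend A).
Proof.
move=> k1 kA; have [s _ q _] := is_bridgeP k1 kA; have Q := fden_gt0 k1 kA.
have := bridge_length k1 kA; rewrite (in_bridgeE _ k1 kA).
have : 0 < (lden A * fden A)^-1 by rewrite invr_gt0 mulr_gt0 //; lra.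
case: s => -> d0 d.
  rewrite min_l ?max_r; [|lra..].
  by split=> [[? ?]|/andP[? ?]]; [apply/andP|]; split; lra.
rewrite min_r ?max_l; [|lra..].
by split=> [[? ?]|/andP[? ?]]; [apply/andP|]; split; lra.
Qed.

Lemma nested_bridges k (A_ : nat -> bridge R) : (1 <= k)%N ->
  (forall i, is_bridge k (A_ i)) ->
  (forall i x, in_bridge (A_ i.+1) x -> in_bridge (A_ i) x) ->
  exists x, forall i, in_bridge (A_ i) x.
Proof.
move=> k1 kA sub.
pose lo i := Num.min (lend (A_ i)) (fend (A_ i)).
pose hi i := Num.max (lend (A_ i)) (fend (A_ i)).
have lohi i : lo i <= hi i by rewrite /lo /hi ge_min !le_max lexx.
have nest i j : (i <= j)%N -> lo i <= lo j <= hi i.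
  move=> /subnK <-; apply/(in_bridge_itv _ k1 (kA i)).
  elim: (j - i)%N {1 3}i => [|l IH] i'.
    by rewrite add0n; apply/(in_bridge_itv _ k1 (kA i')); rewrite lexx lohi.
  by apply: sub; rewrite addSnnS; exact: IH.
have lh i j : lo j <= hi i.
  have [/nest/andP[]//|/ltnW/nest/andP[h _]] := leqP i j.
  exact: le_trans h (lohi i).
(* Every left end is at most every right end, so the supremum of the left ends lies in all the
   intervals. *)
exists (sup (range lo)) => i; apply/(in_bridge_itv _ k1 (kA i)); apply/andP; split.
  suff ub : has_ubound (range lo) by apply: (ub_le_sup ub); exists i.
  by exists (hi 0) => _ [j _ <-].
by apply: ge_sup => [|_ [j _ <-]]; [exists (lo 0), 0 | exact: lh].
Qed.

End Bridges.

(** * Partial quotients of the points of a bridge *)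

Section Quotients.
Variable R : realType.
Implicit Types (A : bridge R) (k : nat) (x : R).

Lemma gauss_map_inv (a : nat) (r y : R) : 0 <= r < 1 -> y^-1 = a%:R + r ->
  Num.truncn y^-1 = a /\ gauss_map y = r.
Proof.
move=> /andP[r0 r1] yE; rewrite /gauss_map yE; split.
  by apply: truncn_def; rewrite -natr1; apply/andP; split; lra.
have -> : Num.floor (a%:R + r) = a%:Z.
  by apply/eqP; rewrite floor_eq intrD -[a%:Z%:~R]/(a%:R); apply/andP; split; lra.
by rewrite -[a%:Z%:~R]/(a%:R); ring.
Qed.

Lemma gauss_map0 : gauss_map 0 = 0 :> R.
Proof. by rewrite /gauss_map invr0 floor0 subr0. Qed.

Lemma gauss_map_ge0 x : 0 <= gauss_map x.
Proof. by rewrite subr_ge0 floor_le. Qed.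

Lemma iter_gauss_neq0 x i n : (i <= n)%N ->
  iter n (@gauss_map R) x != 0 -> iter i (@gauss_map R) x != 0.
Proof.
move=> /subnK <-; rewrite iterD; apply: contra_neq => ->.
by elim: (n - i)%N => //= j ->; exact: gauss_map0.
Qed.

(* The end points of A are cf(a_1, ..., a_j, y) for y = 0 and y = 1/a, hence a point
   of A has the prescribed first j partial quotients, and its j-th Gauss iterate is
   that y. *)
Lemma bridge_quotients k A : (2 <= k)%N -> is_bridge k A ->
  exists j a : nat, [/\ (k <= a)%N, fden A <= (a%:R + 1) * lden A &
  forall x, in_bridge A x ->
  [/\ iter j (@gauss_map R) x * (sgn A * (fnum A - x * fden A)
         + a%:R * (sgn A * (x * lden A - lnum A))) = sgn A * (x * lden A - lnum A),
     forall i, (i < j)%N -> iter i (@gauss_map R) x != 0 /\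
       (k <= Num.truncn (iter i (@gauss_map R) x)^-1)%N &
     lden A <= \prod_(i < j) ((iter i (@gauss_map R) x)^-1 + 1)]].
Proof.
move=> k2; have k1 : (1 <= k)%N by apply: leq_trans k2.
have k2R : 2 <= k%:R :> R by rewrite ler_nat.
elim=> [|{}A kA [j [a [ka aA IH]]]|{}A kA [j [a [ka aA IH]]]].
- exists 0, k; split => //=; first by lra.
  move=> x [/= u v]; split => //; first by ring.
  by rewrite big_ord0.
- exists j, a.+1; split => //=; first exact: leqW.
    by rewrite -natr1; lra.
  move=> x xA; have [yE Hj Hq] := IH x (trunk_sub k1 kA xA); split => //.
  rewrite -natr1 -[RHS]yE; congr (_ * _); ring.
have [_ d q Q] := is_bridgeP k1 kA.
exists j.+1, k; split => //=; first by have := lden_le_fden k1 kA; lra.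
move=> x xT; have [yE Hj Hq] := IH x (tip_sub k1 kA xT).
case: xT => /=; set y := iter j _ x in yE Hj Hq *.
set u := sgn A * (x * lden A - lnum A) in yE *.
set v := sgn A * (fnum A - x * fden A) in yE *.
have -> : - sgn A * (x * fden A - fnum A) = v by rewrite /v; ring.
have -> : - sgn A * (k%:R * fnum A + lnum A - x * (k%:R * fden A + lden A)) = u - k%:R * v.
  by rewrite /v /u; ring.
move=> v0 kvu.
(* By the determinant relation, u and v cannot both vanish. *)
have uvd : fden A * u + lden A * v = 1 by rewrite -d /u /v; ring.
have u0 : 0 < u.
  rewrite lt_neqAle; apply/andP; split; last by nra.
  by apply/eqP => u0; move: uvd; rewrite -u0; nra.
have y0 : y != 0 by apply/eqP => y0; move: yE; rewrite y0; lra.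
have yI : y^-1 = a%:R + v / u.
  apply: (mulfI y0); rewrite mulfV //; apply: (mulIf (lt0r_neq0 u0)).
  by rewrite mul1r -mulrA mulrDl divfK ?lt0r_neq0 // -[LHS]yE; ring.
(* Since k v <= u and k >= 2, v / u is a fractional part: a is the quotient read off at y, and v / u
   is the next Gauss iterate. *)
have vu : 0 <= v / u < 1.
  by rewrite divr_ge0 ?(ltW u0) //= ltr_pdivrMr //; nra.
have [yT yG] := gauss_map_inv vu yI.
split.
- by rewrite yG; field; rewrite lt0r_neq0.
- move=> i; rewrite ltnS leq_eqVlt => /orP[/eqP ->|/Hj //]; split => //.
  by rewrite -/y yT.
rewrite big_ord_recr /= -/y; apply: (le_trans aA).
rewrite mulrC; apply: ler_pM => //; [lra | | ].
  by rewrite addr_ge0 // ler0n.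
by rewrite yI; move/andP: vu => [? _]; lra.
Qed.

(* If fewer than n quotients are prescribed by bridges around x of arbitrarily large
   denominator, then one of the first n Gauss iterates of x vanishes. *)
Lemma cfS_bridges k x : (2 <= k)%N -> in_bridge (root_bridge R k) x ->
  (forall K : R, exists A, [/\ is_bridge k A, in_bridge A x & K <= fden A]) ->
  cfS R k x.
Proof.
move=> k2 [/= x0 xk] H; have k2R : 2 <= k%:R :> R by rewrite ler_nat.
have {}x0 : 0 <= x by lra.
split; first by apply/andP; split; nra.
case=> // n a _; rewrite /partial_quotient /=.
set y := iter n _ x; case: eqVneq => // y0 [<-].
(* The product bounds [fden A] as long as at most n quotients are prescribed; adding 1 makes the
   contradiction strict. *)
have [A [kA xA KA]] := H (\prod_(i < n.+1) ((iter i (@gauss_map R) x)^-1 + 1) + 1).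
have [j [b [kb bA /(_ x xA)[yE Hj Hq]]]] := bridge_quotients k2 kA.
have [nj|jn] := ltnP n j; first by have [] := Hj _ nj.
exfalso; move: KA; apply/negP; rewrite -ltNge.
have f1 i : 1 <= (iter i (@gauss_map R) x)^-1 + 1.
  rewrite lerDr invr_ge0; case: i => //= i; exact: gauss_map_ge0.
set yj := iter j (@gauss_map R) x in yE.
have yj0 : yj != 0 by apply: iter_gauss_neq0 jn y0.
have [_ d q _] := is_bridgeP (leq_trans (isT : 1 <= 2)%N k2) kA.
case: xA; set u := sgn A * (x * lden A - lnum A) in yE *.
set v := sgn A * (fnum A - x * fden A) in yE *.
move=> u0 v0.
have byj : b%:R <= yj^-1.
  have u_neq0 : u != 0.
    apply/eqP => uE; move/eqP: yE; rewrite uE mulr0 addr0 mulf_eq0 (negPf yj0) /= => /eqP vE.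
    have : fden A * u + lden A * v = 1 by rewrite -d /u /v; ring.
    by rewrite uE vE; lra.
  have up : 0 < u by rewrite lt_neqAle eq_sym u_neq0.
  rewrite -(ler_pM2r up).
  have -> : yj^-1 * u = v + b%:R * u by rewrite -{1}yE mulrA mulVf ?mul1r.
  by rewrite lerDr.
apply: (@le_lt_trans _ _ (\prod_(i < j.+1) ((iter i (@gauss_map R) x)^-1 + 1))).
  apply: (le_trans bA); rewrite big_ord_recr /= -/yj mulrC.
  by apply: ler_pM => //; [lra | rewrite addr_ge0 ?ler0n | lra].
apply: (@le_lt_trans _ _ (\prod_(i < n.+1) ((iter i (@gauss_map R) x)^-1 + 1))); last by lra.
rewrite -!(big_mkord xpredT (fun i => (iter i (@gauss_map R) x)^-1 + 1)).
rewrite [leRHS](@big_cat_nat _ _ _ j.+1) //= ler_peMr //.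
  by apply: prodr_ge0 => i _; apply: le_trans (f1 i).
by elim/big_ind: _ => // *; apply: mulr_ege1.
Qed.
(** The bound on the first quotient suffices; this yields the easy inclusion. *)
Lemma cfS_le k x : (1 <= k)%N -> cfS R k x -> 0 <= x <= k%:R^-1.
Proof.
move=> k1 [/andP[x0 x1] H]; rewrite x0 /=.
have [->|xn0] := eqVneq x 0; first by rewrite invr_ge0.
have xp : 0 < x by rewrite lt_neqAle eq_sym xn0.
have kx : (k <= Num.truncn x^-1)%N.
  by apply: (H 1) => //; rewrite /partial_quotient /= (negPf xn0).
rewrite -[x]invrK lef_pV2 ?posrE ?invr_gt0 ?ltr0n //.
by rewrite -truncn_ge_nat ?invr_ge0.
Qed.

End Quotients.

(** * Linked pairs *)

Section Pairs.
Variables (R : realType) (m : nat) (t : R).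
Hypothesis m2 : (2 <= m)%N.
Implicit Types A B : bridge R.
Local Notation M := (m%:R : R).

(** The last two conditions place t in A + B, read in the direction of [sgn A]. With equal
    orientations the sum runs from [lend A + lend B] to [fend A + fend B]; in [opposed] the ends of
    B are exchanged. *)
Definition aligned A B :=
  [/\ sgn B = sgn A, M * fden A <= fden B,
      0 <= sgn A * (t - lend A - lend B) & 0 <= sgn A * (fend A + fend B - t)].

Definition opposed A B :=
  [/\ sgn B = - sgn A,
      M * fden A <= M ^+ 2 * fden B + lden B /\ M * lden A <= fden B,
      (M ^+ 2 - M + 1) * lden B <= fden A + lden A,
      0 <= sgn A * (t - lend A - fend B) & 0 <= sgn A * (fend A + lend B - t)].

Definition linked A B :=
  [/\ is_bridge m A, is_bridge (m ^ 2) B,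
    (M - 1) * (lden B * fden B) <= (fden A + lden A) * (M * fden A + lden A) &
    aligned A B \/ opposed A B].

Definition refines A B A' B' :=
  [/\ forall x, in_bridge A' x -> in_bridge A x,
      forall x, in_bridge B' x -> in_bridge B x &
      fden A + fden B + 1 <= fden A' + fden B'].

Lemma m_bounds : [/\ (1 <= m)%N, (1 <= m ^ 2)%N & 2 <= M].
Proof.
have m1 : (1 <= m)%N by exact: leq_trans m2.
by split; rewrite ?expn_gt0 ?m1 ?ler_nat.
Qed.

(** * Refining a linked pair *)

Lemma gap_le_length A B : is_bridge m A -> is_bridge (m ^ 2) B ->
  (M - 1) * (lden B * fden B) <= (fden A + lden A) * (M * fden A + lden A) ->
  sgn A * (fend (tip m A) - fend (trunk A)) <= sgn B * (fend B - lend B).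
Proof.
have [m1 n1 M2] := m_bounds; move=> mA nB I; rewrite (gap_length m1 mA) (bridge_length n1 nB).
have [_ _ q _] := is_bridgeP m1 mA; have Q := fden_gt0 m1 mA.
have [_ _ s _] := is_bridgeP n1 nB; have S := fden_gt0 n1 nB.
have sS : 0 < lden B * fden B by rewrite mulr_gt0 //; lra.
have z : 0 < M * fden A + lden A by rewrite addr_gt0 ?mulr_gt0 //; lra.
rewrite ler_pdivrMr; last by rewrite mulr_gt0 //; lra.
by rewrite mulrC ler_pdivlMr.
Qed.

Lemma aligned_step A B : is_bridge m A -> is_bridge (m ^ 2) B ->
  (M - 1) * (lden B * fden B) <= (fden A + lden A) * (M * fden A + lden A) ->
  aligned A B -> exists A' B', linked A' B' /\ refines A B A' B'.
Proof.
have [m1 n1 M2] := m_bounds; move=> mA nB I [sAB C lo hi].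
have [_ _ q qQ] := is_bridgeP m1 mA; have Q := fden_gt0 m1 mA.
have [_ _ s sS] := is_bridgeP n1 nB; have S := fden_gt0 n1 nB.
have mT := is_bridge_tip mA; have mL := is_bridge_trunk mA.
rewrite natrX in sS.
have qQ' := lden_le_fden m1 mA.
have QM : 0 <= (M - 2) * fden A by rewrite mulr_ge0 //; lra.
(* In the direction of [sgn A], the sum of the tip of A and B starts at [fend (tip m A) + lend B].
   If t is not before this point, the tip is taken. *)
have [tip_t|t_tip] := leP 0 (sgn A * (t - fend (tip m A) - lend B)).
  exists (tip m A), B; split; last first.
    by split=> // [x /(tip_sub m1 mA)|/=] //; lra.
  split=> //=.
    apply: (le_trans I); apply: gap_den_mono; try (apply/andP; split); lra.
  right; split=> //=; first by rewrite sAB opprK.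
  - split => //; have : 0 <= (M ^+ 2 - M - 1) * fden B by rewrite mulr_ge0 //; nra.
    have : M * (M * fden A) <= M * fden B by rewrite ler_wpM2l //; lra.
    lra.
  - by apply: (@same_tip_ineq _ _ _ _ _ (fden B)); rewrite //; lra.
  - rewrite -[lend (tip m A)]/(fend A); lra.
  - lra.
(* Otherwise B is shortened until it can be aligned with the trunk of A. As B' still spans the gap
   of A, the new sum reaches the point where the other one started. *)
have [j [jw jB]] := iter_trunk_ge (M * (fden A + lden A)) n1 nB.
have := iter_trunk_sub (j := j) n1 nB; have := iter_trunk j nB.
set B' := iter j _ B in jw jB *; move=> [nB' sB' pB' qB' _] subB'.
have I' : (M - 1) * (lden B' * fden B') <= (fden A + lden A) * (M * fden A + lden A).
  case: jB => [-> //|[Bw B'w]]; rewrite qB'.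
  by apply: same_left_ineq; rewrite //; lra.
have := gap_le_length mA nB' I'.
have lB' : lend B' = lend B by rewrite /lend pB' qB'.
rewrite sB' sAB lB' => gap.
have BB' : fden B <= fden B'.
  by case: jB => [-> //|[Bw _]]; lra.
exists (trunk A), B'; split; last first.
  by split=> // [x /(trunk_sub m1 mA)|/=] //; lra.
split=> //=.
  by apply: (le_trans I'); apply: gap_den_mono; try (apply/andP; split); lra.
left; split=> //=; rewrite ?sB' ?lB' //; lra.
Qed.

Lemma opposed_step A B : is_bridge m A -> is_bridge (m ^ 2) B ->
  (M - 1) * (lden B * fden B) <= (fden A + lden A) * (M * fden A + lden A) ->
  opposed A B -> exists A' B', linked A' B' /\ refines A B A' B'.
Proof.
have [m1 n1 M2] := m_bounds; move=> mA nB I [sAB [C3 C1] C2 lo hi].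
have [_ _ q qQ] := is_bridgeP m1 mA; have Q := fden_gt0 m1 mA.
have [_ _ s sS] := is_bridgeP n1 nB; have S := fden_gt0 n1 nB.
have mT := is_bridge_tip mA; have mL := is_bridge_trunk mA.
have nT := is_bridge_tip nB; have nL := is_bridge_trunk nB.
have nE : (m ^ 2)%:R = M ^+ 2 by rewrite natrX.
rewrite nE in sS.
have qQ' := lden_le_fden m1 mA.
have QM : 0 <= (M - 2) * fden A by rewrite mulr_ge0 //; lra.
(* This decides which bridge is cut: A if its trunk can stay opposed to B, and B otherwise. *)
have [wP|Pw] := leP (M * (fden A + lden A)) (M ^+ 2 * fden B + lden B).
  have [t_left|left_t] := leP 0 (sgn A * (fend (trunk A) + lend B - t)).
    exists (trunk A), B; split; last first.
      by split=> // [x /(trunk_sub m1 mA)|/=] //; lra.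
    split=> //=; first by apply: (le_trans I); apply: gap_den_mono; try (apply/andP; split); lra.
    by right; split=> //=; lra.
  (* Beyond the sum of the trunk of A and B, the tip of A is used. It has the orientation of B, so B
     is shortened to meet the aligned condition while keeping its end [lend B]. *)
  have [j [jw jB]] := iter_trunk_ge (M * (M * fden A + lden A)) n1 nB.
  have := iter_trunk_sub (j := j) n1 nB; have := iter_trunk j nB.
  set B' := iter j _ B in jw jB *; move=> [nB' sB' pB' qB' _] subB'.
  have I' : (M - 1) * (lden B' * fden B') <= (fden A + lden A) * (M * fden A + lden A).
    case: jB => [-> //|[Bw B'w]]; rewrite qB'.
    by apply: opp_tip_ineq; rewrite //; lra.
  have := gap_le_length mA nB' I'.
  have lB' : lend B' = lend B by rewrite /lend pB' qB'.
  rewrite sB' sAB lB' => gap.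
  have BB' : fden B <= fden B' by case: jB => [-> //|[Bw _]]; lra.
  exists (tip m A), B'; split; last first.
    by split=> // [x /(tip_sub m1 mA)|/=] //; lra.
  split=> //=.
    by apply: (le_trans I'); apply: gap_den_mono; try (apply/andP; split); lra.
  left; split=> //=; rewrite ?sB' ?lB' //.
    by rewrite -[lend (tip m A)]/(fend A); lra.
  lra.
have [left_t|t_left] := leP 0 (sgn A * (t - lend A - fend (trunk B))).
  exists A, (trunk B); split; last first.
    by split=> // [x /(trunk_sub n1 nB)|/=] //; lra.
  split=> //=; first by apply: opp_left_ineq; rewrite //; lra.
  by right; split=> //=; try split; nra.
exists A, (tip (m ^ 2) B); split; last first.
  split=> // [x /(tip_sub n1 nB)|/=] //; rewrite nE.
  have : 0 <= (M ^+ 2 - 1) * fden B by rewrite mulr_ge0 //; nra.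
  lra.
(* A spans the gap of B, so the sums of A with the two pieces of B leave no hole. *)
have gap : - sgn A * (fend (tip (m ^ 2) B) - fend (trunk B)) <= sgn A * (fend A - lend A).
  rewrite -sAB (gap_length n1 nB) (bridge_length m1 mA) nE.
  have qQ0 : 0 < lden A * fden A by rewrite mulr_gt0 //; lra.
  have P0 : 0 < M ^+ 2 * fden B + lden B by rewrite addr_gt0 ?mulr_gt0 ?exprn_gt0 //; lra.
  rewrite ler_pdivrMr; last by rewrite mulr_gt0 //; lra.
  rewrite mulrC ler_pdivlMr //.
  by apply: opp_gap_ineq; rewrite //; lra.
split=> //=; rewrite ?nE.
  by apply: opp_switch_ineq; rewrite //; lra.
by left; split=> //=; rewrite ?nE ?sAB ?opprK //; lra.
Qed.

(** * Limits of linked pairs *)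

Lemma linked_root : 0 <= t <= (M + 1) / M ^+ 2 ->
  linked (root_bridge R m) (root_bridge R (m ^ 2)).
Proof.
have [m1 n1 M2] := m_bounds.
move=> /andP[t0 tM]; split; [exact: is_bridge_root | exact: is_bridge_root | | left].
  by rewrite /= natrX; nra.
split=> //=; rewrite ?natrX //; rewrite /lend /fend /= ?natrX; first by lra.
have -> : 1 / M + 1 / M ^+ 2 = (M + 1) / M ^+ 2 by field; rewrite gt_eqF //; lra.
lra.
Qed.

Lemma linked_step A B : linked A B ->
  exists A' B', linked A' B' /\ refines A B A' B'.
Proof. by case=> mA nB I []; [apply: aligned_step | apply: opposed_step]. Qed.

(** The two outer denominators control each other: S <= 2 (M + 1) Q^2 by the gap condition and Q <=
    (M^2 + 1) S by either alternative. So both are large once their sum is. *)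
Lemma linked_den A B (K : R) : linked A B -> 0 < K ->
  (M ^+ 2 + 2) * K + 2 * (M + 1) * K ^+ 2 <= fden A + fden B ->
  K <= fden A /\ K <= fden B.
Proof.
have [m1 n1 M2] := m_bounds.
case=> mA nB I S_.
have [_ _ q _] := is_bridgeP m1 mA; have Q := fden_gt0 m1 mA.
have [_ _ s _] := is_bridgeP n1 nB; have S := fden_gt0 n1 nB.
have qQ := lden_le_fden m1 mA; have sS := lden_le_fden n1 nB.
have SQ : fden B <= 2 * (M + 1) * fden A ^+ 2.
  have : (fden A + lden A) * (M * fden A + lden A) <= (fden A + fden A) * (M * fden A + fden A).
    by apply: gap_den_mono; try (apply/andP; split); lra.
  have : fden B <= (M - 1) * (lden B * fden B).
    have : fden B <= lden B * fden B by rewrite ler_peMl //; lra.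
    have : 0 <= (M - 2) * (lden B * fden B) by rewrite !mulr_ge0 //; lra.
    lra.
  lra.
have QS : fden A <= (M ^+ 2 + 1) * fden B.
  have : fden A <= M * fden A by rewrite ler_peMl //; lra.
  have : 0 <= M ^+ 2 * fden B by rewrite mulr_ge0 ?sqr_ge0 //; lra.
  by case: S_ => [[_ C _ _]|[_ [C _] _ _ _]]; lra.
move=> K0 N; split; rewrite leNgt; apply/negP => lt_K.
  have : 2 * (M + 1) * fden A ^+ 2 <= 2 * (M + 1) * K ^+ 2.
    by rewrite ler_wpM2l ?ler_sqr ?nnegrE //; lra.
  have : 0 <= M ^+ 2 * K by rewrite mulr_ge0 ?sqr_ge0 //; lra.
  lra.
have : (M ^+ 2 + 1) * fden B <= (M ^+ 2 + 1) * K.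
  by rewrite ler_wpM2l //; [have := sqr_ge0 M; lra | lra].
have : 0 <= (M + 1) * K ^+ 2 by rewrite mulr_ge0 ?sqr_ge0 //; lra.
lra.
Qed.

(** Both c + b and t lie in A + B, and each bridge has length at most 1/K. *)
Lemma linked_dist A B (c b K : R) : linked A B -> in_bridge A c ->
  in_bridge B b -> 0 < K -> K <= fden A -> K <= fden B -> `|c + b - t| <= 2 / K.
Proof.
have [m1 n1 M2] := m_bounds.
case=> mA nB _ S_ /(in_bridgeE _ m1 mA)[c1 c2] /(in_bridgeE _ n1 nB)[b1 b2] K0 KA KB.
have lenK k C : (1 <= k)%N -> is_bridge k C -> K <= fden C -> sgn C * (fend C - lend C) <= K^-1.
  move=> k1 kC KC; rewrite (bridge_length k1 kC).
  have [_ _ q _] := is_bridgeP k1 kC.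
  have Q0 := lt_le_trans K0 KC; have q0 : 0 < lden C by lra.
  rewrite lef_pV2 ?posrE ?mulr_gt0 //; apply: (le_trans KC).
  by rewrite ler_peMl // ltW.
have := lenK _ _ m1 mA KA; have := lenK _ _ n1 nB KB.
have [sA _ _ _] := is_bridgeP m1 mA.
case: S_ => [[sB _ lo hi]|[sB _ _ lo hi]]; rewrite sB in b1 b2 *;
  case: sA => sA; rewrite sA in c1 c2 b1 b2 lo hi * => lB lA; rewrite ler_norml; apply/andP; split; lra.
Qed.

Lemma linked_sum : 0 <= t <= (M + 1) / M ^+ 2 ->
  exists c b, [/\ cfS R m c, cfS R (m ^ 2) b & c + b = t].
Proof.
move=> tI; have [m1 n1 M2] := m_bounds.
have n2 : (2 <= m ^ 2)%N by rewrite (leq_trans m2) // -[leqLHS]expn1 leq_pexp2l.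
(* Stated as an implication, the step is total on pairs, so that a choice function can be
   iterated. *)
have /choice[f Hf] (X : bridge R * bridge R) : exists Y : bridge R * bridge R,
    linked X.1 X.2 -> linked Y.1 Y.2 /\ refines X.1 X.2 Y.1 Y.2.
  have [/linked_step[A' [B' H]]|nX] := pselect (linked X.1 X.2).
    by exists (A', B').
  by exists X.
pose X i := iter i f (root_bridge R m, root_bridge R (m ^ 2)).
have LX i : linked (X i).1 (X i).2.
  by elim: i => [|i /Hf[]//]; exact: linked_root.
have RX i : refines (X i).1 (X i).2 (X i.+1).1 (X i.+1).2 by have [] := Hf _ (LX i).
have [c cX] : exists c, forall i, in_bridge (X i).1 c.
  by apply: (@nested_bridges _ m) => // i; [have [] := LX i | have [] := RX i].
have [b bX] : exists b, forall i, in_bridge (X i).2 b.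
  by apply: (@nested_bridges _ (m ^ 2)) => // i; [have [] := LX i | have [] := RX i].
have grow i : i%:R <= fden (X i).1 + fden (X i).2.
  elim: i => [|i IH]; last by have [_ _] := RX i; rewrite -natr1; lra.
  by rewrite /= -natrD ler_nat.
have big (K : R) : exists i, K <= fden (X i).1 /\ K <= fden (X i).2.
  (* The maximum with 1 secures the positivity required by [linked_den]. *)
  set L := Num.max K 1; set N := (M ^+ 2 + 2) * L + 2 * (M + 1) * L ^+ 2.
  have L0 : 0 < L by rewrite lt_max ltr01 orbT.
  have KL : K <= L by rewrite le_max lexx.
  have /(linked_den (LX _) L0)[LA LB] := le_trans (ltW (truncnS_gt N)) (grow _).
  by exists (Num.truncn N).+1; split; exact: le_trans KL _.
exists c, b; split.
- apply: cfS_bridges => //; first exact: cX 0.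
  by move=> K; have [i [KA _]] := big K; exists (X i).1; split=> //; have [] := LX i.
- apply: cfS_bridges => //; first exact: bX 0.
  by move=> K; have [i [_ KB]] := big K; exists (X i).2; split=> //; have [] := LX i.
apply/eqP; rewrite -subr_eq0 -normr_le0; apply/ler_addgt0Pl => e e0.
have K0 : 0 < 2 / e by rewrite divr_gt0.
(* With K = 2/e the distance bound 2/K is exactly e. *)
have [i [KA KB]] := big (2 / e).
have := linked_dist (LX i) (cX i) (bX i) K0 KA KB.
by rewrite addr0 invf_div mulrCA divff ?mulr1 // pnatr_eq0.
Qed.

End Pairs.

Theorem theorem4 (R : realType) (m : nat) (hm : (2 <= m)%N) :
  [set c + b | c in cfS R m & b in cfS R (m ^ 2)%N]
  = `[0, (m%:R + 1) / m%:R ^+ 2]%classic.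
Proof.
have m1 : (1 <= m)%N by exact: leq_trans hm.
have n1 : (1 <= m ^ 2)%N by rewrite expn_gt0 m1.
apply/seteqP; split=> [_ [c /(cfS_le m1)/andP[c0 cm] [b /(cfS_le n1)/andP[b0 bm] <-]]|t].
  rewrite /= in_itv /= addr_ge0 //=.
  have -> : (m%:R + 1) / m%:R ^+ 2 = m%:R^-1 + (m ^ 2)%:R^-1 :> R.
    by rewrite natrX; field; rewrite pnatr_eq0 -lt0n.
  exact: lerD.
rewrite /= in_itv /= => /(linked_sum hm)[c [b [cS bS <-]]].
by exists c => //; exists b.
Qed.
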